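(* Let $k$ be a field and let $\mathcal A$ be a finite set of hyperplanes through the origin in $\mathbb R^d$, with face semigroup $\mathcal F$, intersection lattice $\mathcal L$ and face semigroup algebra $k\mathcal F$. Let $\{e_X\}_{X\in\mathcal L}$ be the complete system of primitive orthogonal idempotents of $k\mathcal F$ defined by fixing, for each $X\in\mathcal L$, a face $x$ with $\operatorname{supp}(x)=X$ and setting recursively $e_X=x-\sum_{Y>X}x\,e_Y$. Then for all $X,Y\in\mathcal L$, $$\dim_k\operatorname{Hom}_{k\mathcal F}(k\mathcal F e_X,k\mathcal F e_Y)=|\mu(X,Y)|,$$ where $\mu$ is the Möbius function of $\mathcal L$. Therefore the Cartan invariants of $k\mathcal F$ are $c_{X,Y}=|\mu(X,Y)|$, and the Cartan matrix $[c_{X,Y}]$ is triangular (with respect to a suitable ordering of $\mathcal L$) of determinant $1$.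
   Context: For each $H\in\mathcal A$ fix a labelling $H^+,H^-$ of the two open half-spaces determined by $H$, and put $H^0=H$. A face of $\mathcal A$ is a nonempty set of the form $x=\bigcap_{H\in\mathcal A}H^{\sigma_H}$ with $\sigma_H\in\{+,-,0\}$; write $\sigma_H(x)=\sigma_H$. $\mathcal F$ is the set of faces. The support of a face is $\operatorname{supp}(x)=\bigcap_{H:\sigma_H(x)=0}H$ (equal to $\mathbb R^d$ if no $\sigma_H(x)$ is $0$). The intersection lattice $\mathcal L=\operatorname{supp}(\mathcal F)$ (equivalently, the set of intersections of subsets of $\mathcal A$) is ordered by inclusion. The product $xy$ of faces is the face with $\sigma_H(xy)=\sigma_H(x)$ if $\sigma_H(x)\ne0$ and $\sigma_H(xy)=\sigma_H(y)$ if $\sigma_H(x)=0$. This makes $\mathcal F$ a semigroup with identity $1=\bigcap_{H\in\mathcal A}H$, and $k\mathcal F$ is its semigroup algebra over $k$. For a complete system $\{e_X\}_{X\in I}$ of primitive orthogonal idempotents of a finite dimensional $k$-algebra $A$ (primitive, pairwise orthogonal, summing to $1$), the Cartan invariants are $c_{X,Y}=\dim_k\operatorname{Hom}_A(Ae_X,Ae_Y)$ and the Cartan matrix is $[c_{X,Y}]$. The Möbius function of a finite poset is the integer-valued function with $\mu(x,x)=1$, $\mu(x,y)=-\sum_{x\le z<y}\mu(x,z)$ for $x<y$, and $\mu(x,y)=0$ if $x\not\le y$. *)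

(* Defs.v *)
From HB Require Import structures.
From mathcomp Require Import all_boot all_order all_algebra all_fingroup all_field.
From mathcomp Require Import boolp classical_sets reals.

Set Implicit Arguments.
Unset Strict Implicit.
Unset Printing Implicit Defensive.

Import Order.TTheory GRing.Theory Num.Theory.
Local Open Scope ring_scope.

(* The algebra over k of the finite monoid (M, op, one): functions M -> k under
   convolution, f standing for the formal sum of the (f x) x. *)
Definition monoid_alg (k : fieldType) (M : finType) (one : M)
    (op : Monoid.law one) : Type :=
  {ffun M -> k^o}.

Section MonoidAlgebra.
Context {k : fieldType} {M : finType} {one : M} {op : Monoid.law one}.
Local Notation kM := (monoid_alg k op).

HB.instance Definition _ := Vector.copy kM {ffun M -> k^o}.

Implicit Types f g h : kM.

Definition alg_of (x : M) : kM := [ffun y => (y == x)%:R].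

Definition monoid_alg_one : kM := alg_of one.

Definition monoid_alg_mul f g : kM :=
  [ffun z => \sum_(p : M * M | op p.1 p.2 == z) f p.1 * g p.2].

Lemma monoid_alg_mulE f g z :
  monoid_alg_mul f g z =
  \sum_x \sum_y f x * g y * (op x y == z)%:R.
Proof.
rewrite ffunE pair_big /= big_mkcond /=; apply: eq_bigr => p _.
by case: eqP; rewrite ?mulr1 ?mulr0.
Qed.

Fact monoid_alg_mulA : associative monoid_alg_mul.
Proof.
move=> f g h; apply/ffunP => z; rewrite !monoid_alg_mulE.
transitivity (\sum_x \sum_y \sum_t
    f x * g y * h t * (op (op x y) t == z)%:R).
  apply: eq_bigr => x _; under eq_bigr => w _.
    rewrite monoid_alg_mulE mulr_sumr mulr_suml.
    under eq_bigr => y _ do rewrite mulr_sumr mulr_suml.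
    over.
  rewrite exchange_big; apply: eq_bigr => y _.
  rewrite exchange_big; apply: eq_bigr => t _.
  rewrite (bigD1 (op y t)) //= big1 ?addr0.
    by rewrite eqxx mulr1 !mulrA Monoid.mulmA.
  by move=> w nw; rewrite [_ == w]eq_sym (negPf nw) !(mulr0, mul0r).
symmetry.
under eq_bigr => w _ do under eq_bigr => t _ do
  (rewrite monoid_alg_mulE !mulr_suml;
   under eq_bigr => x _ do rewrite !mulr_suml).
transitivity (\sum_t \sum_w \sum_x \sum_y
   (f x * g y * (op x y == w)%:R * h t * (op w t == z)%:R)).
  exact: exchange_big.
transitivity (\sum_t \sum_x \sum_y
    f x * g y * h t * (op (op x y) t == z)%:R).
  apply: eq_bigr => t _; rewrite exchange_big; apply: eq_bigr => x _.
  rewrite exchange_big; apply: eq_bigr => y _.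
  rewrite (bigD1 (op x y)) //= big1 ?addr0.
    by rewrite eqxx mulr1.
  by move=> w nw; rewrite [_ == w]eq_sym (negPf nw) !(mulr0, mul0r).
rewrite exchange_big; apply: eq_bigr => x _.
by rewrite exchange_big.
Qed.

Fact monoid_alg_mul1 : left_id monoid_alg_one monoid_alg_mul.
Proof.
move=> f; apply/ffunP => z; rewrite monoid_alg_mulE.
rewrite (bigD1 one) //= [X in _ + X]big1 ?addr0; last first.
  by move=> x nx; rewrite big1 // => y _; rewrite ffunE (negPf nx) !mul0r.
rewrite (bigD1 z) //= big1 ?addr0 ?Monoid.mul1m ?ffunE ?eqxx ?mul1r ?mulr1 //.
by move=> y ny; rewrite Monoid.mul1m (negPf ny) mulr0.
Qed.

Fact monoid_alg_mulr1 : right_id monoid_alg_one monoid_alg_mul.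
Proof.
move=> f; apply/ffunP => z; rewrite monoid_alg_mulE exchange_big.
rewrite (bigD1 one) //= [X in _ + X]big1 ?addr0; last first.
  by move=> x nx; rewrite big1 // => y _; rewrite ffunE (negPf nx) mulr0 mul0r.
rewrite (bigD1 z) //= big1 ?addr0 ?Monoid.mulm1 ?ffunE ?eqxx ?mulr1 //.
by move=> y ny; rewrite Monoid.mulm1 (negPf ny) mulr0.
Qed.

Fact monoid_alg_mulDl : left_distributive monoid_alg_mul +%R.
Proof.
move=> f g h; apply/ffunP => z; rewrite !ffunE -big_split.
by apply: eq_bigr => p _; rewrite ffunE mulrDl.
Qed.

Fact monoid_alg_mulDr : right_distributive monoid_alg_mul +%R.
Proof.
move=> f g h; apply/ffunP => z; rewrite !ffunE -big_split.
by apply: eq_bigr => p _; rewrite ffunE mulrDr.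
Qed.

Fact monoid_alg_one_neq0 : monoid_alg_one != 0.
Proof.
apply/eqP => /ffunP/(_ one); rewrite !ffunE eqxx => /eqP.
by rewrite oner_eq0.
Qed.

HB.instance Definition _ := GRing.Zmodule_isNzRing.Build kM
  monoid_alg_mulA monoid_alg_mul1 monoid_alg_mulr1
  monoid_alg_mulDl monoid_alg_mulDr monoid_alg_one_neq0.

Fact monoid_alg_scaleAl (c : k) f g : c *: (f * g) = (c *: f) * g.
Proof.
apply/ffunP => z; rewrite !ffunE scaler_sumr.
by apply: eq_bigr => p _; rewrite ffunE scalerAl.
Qed.

HB.instance Definition _ := GRing.Lmodule_isLalgebra.Build k kM
  monoid_alg_scaleAl.

Fact monoid_alg_scaleAr (c : k) f g : c *: (f * g) = f * (c *: g).
Proof.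
apply/ffunP => z; rewrite !ffunE scaler_sumr.
by apply: eq_bigr => p _; rewrite ffunE scalerAr.
Qed.

HB.instance Definition _ := GRing.Lalgebra_isAlgebra.Build k kM
  monoid_alg_scaleAr.

HB.instance Definition _ := Algebra_isFalgebra.Build k kM.

Lemma alg_ofM (x y : M) : alg_of (op x y) = alg_of x * alg_of y.
Proof.
apply/ffunP => z; rewrite [RHS]monoid_alg_mulE.
rewrite (bigD1 x) //= [X in _ + X]big1 ?addr0; last first.
  by move=> t nt; rewrite big1 // => u _; rewrite !ffunE (negPf nt) !mul0r.
rewrite (bigD1 y) //= big1 ?addr0; last first.
  by move=> u nu; rewrite !ffunE (negPf nu) mulr0 mul0r.
by rewrite !ffunE !eqxx !mul1r eq_sym.
Qed.

Lemma alg_of1 : alg_of one = 1.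
Proof. by []. Qed.

Lemma monoid_alg_sum f : f = \sum_x f x *: alg_of x.
Proof.
apply/ffunP => z; rewrite sum_ffunE (bigD1 z) //= big1 ?addr0.
  by rewrite !ffunE eqxx /GRing.scale /= mulr1.
by move=> x nx; rewrite !ffunE eq_sym (negPf nx) scaler0.
Qed.

End MonoidAlgebra.

Section CartanInvariants.
Context {k : fieldType} {A : falgType k}.

Definition idempotent_elt (e : A) : Prop := e * e = e.

Definition primitive_idempotent (e : A) : Prop :=
  [/\ idempotent_elt e, e != 0 &
      forall f g : A, idempotent_elt f -> idempotent_elt g ->
        f * g = 0 -> g * f = 0 -> e = f + g -> f = 0 \/ g = 0].

Definition complete_system (I : finType) (e : I -> A) : Prop :=
  [/\ forall i, primitive_idempotent (e i),
      forall i j, i != j -> e i * e j = 0 &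
      \sum_i e i = 1].

Definition left_ideal (e : A) : {vspace A} := limg (amulr e).

Lemma left_idealP e u : reflect (exists a, u = a * e) (u \in left_ideal e).
Proof.
apply: (iffP memv_imgP) => [[a _ ->]|[a ->]].
  by exists a; rewrite lfunE.
by exists a; rewrite ?memvf ?lfunE.
Qed.

Lemma left_ideal_closed e a u : u \in left_ideal e -> a * u \in left_ideal e.
Proof.
case/left_idealP => b ->; apply/left_idealP.
by exists (a * b); rewrite mulrA.
Qed.

(* Hom_A(U, V) for left ideals U and V, as a subspace of Hom_k(U, V):
   the kernel of the defects of A-linearity at basis vectors (see homAP). *)
Section HomA.
Variables U V : {vspace A}.
Local Notation HomUV := 'Hom(subvs_of U, subvs_of V).

Definition hom_defect (a : A) (u : subvs_of U) (f : HomUV) : A :=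
  vsval (f (vsproj U (a * vsval u))) - a * vsval (f u).

Fact hom_defect_is_linear a u : linear (hom_defect a u).
Proof.
move=> c f g; rewrite /hom_defect !add_lfunE !scale_lfunE !linearP /=.
by rewrite mulrDr -scalerAr scalerBr opprD addrACA.
Qed.

HB.instance Definition _ a u :=
  GRing.isLinear.Build k HomUV A _ (hom_defect a u) (hom_defect_is_linear a u).

Definition homA : {vspace HomUV} :=
  (\bigcap_(i < \dim {:A}) \bigcap_(j < \dim {:subvs_of U})
    lker (linfun (hom_defect (vbasis {:A})`_i (vbasis {:subvs_of U})`_j)))%VS.

Lemma homAP (f : HomUV) :
  (forall a u, u \in U -> a * u \in U) ->
  reflect (forall (a : A) (u w : subvs_of U),
             vsval w = a * vsval u -> vsval (f w) = a * vsval (f u))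
          (f \in homA).
Proof.
move=> idealU.
have defect0 : f \in homA -> forall a u, hom_defect a u f = 0.
  rewrite memvE => /subv_bigcapP fb.
  have fb2 (i : 'I_(\dim {:A})) (j : 'I_(\dim {:subvs_of U})) :
      hom_defect (vbasis {:A})`_i (vbasis {:subvs_of U})`_j f = 0.
    by have /subv_bigcapP/(_ j isT) := fb i isT;
      rewrite -memvE memv_ker lfunE => /eqP.
  move=> a u; rewrite (coord_vbasis (memvf a)) (coord_vbasis (memvf u)).
  rewrite /hom_defect !linear_sum /= mulr_suml !linear_sum /= mulr_suml.
  rewrite -sumrB big1 // => i _.
  rewrite mulr_sumr !linear_sum /= mulr_sumr -sumrB big1 // => j _.
  rewrite -!scalerAl -!scalerAr !linearZ /= -scalerAr -scalerN -!scalerDr.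
  by rewrite [X in _ *: (_ *: X)]fb2 !scaler0.
apply: (iffP idP) => [/defect0 f0 a u w wau|fA].
  apply/eqP; rewrite -subr_eq0 -(f0 a u) /hom_defect -wau vsvalK.
  exact/eqP.
rewrite memvE; apply/subv_bigcapP => i _; apply/subv_bigcapP => j _.
rewrite -memvE memv_ker lfunE /hom_defect subr_eq0; apply/eqP/fA.
by rewrite vsprojK ?idealU ?subvsP.
Qed.

End HomA.

Definition cartan_inv (I : finType) (e : I -> A) (i j : I) : nat :=
  \dim (homA (left_ideal (e i)) (left_ideal (e j))).

(* The index set is listed by s to give meaning to triangularity. *)
Definition cartan_mx (I : finType) (e : I -> A) (n : nat) (s : 'I_n -> I)
    : 'M[int]_n :=
  \matrix_(i, j) (cartan_inv e (s i) (s j))%:Z.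

End CartanInvariants.

Section Mobius.
Context {disp : Order.disp_t} {T : finPOrderType disp}.
Local Open Scope order_scope.

(* n bounds the depth of the recursion on [x, y[. *)
Fixpoint mobius_rec (n : nat) (x y : T) : int :=
  if n is n'.+1 then
    if x == y then 1%R
    else if x < y then (- \sum_(z | (x <= z < y)%O) mobius_rec n' x z)%R
    else 0%R
  else 0%R.

Definition mobius (x y : T) : int := mobius_rec #|T|.+1 x y.

Let itv (x y : T) := [pred z | x <= z < y].

Lemma mobius_rec_stable n m x y :
  (#|itv x y| < n)%N -> (#|itv x y| < m)%N ->
  mobius_rec n x y = mobius_rec m x y.
Proof.
elim: n m y => // n IHn [//|m] y ltn ltm /=.
case: ifP => // _; case: ifP => // ltxy; congr (- _)%R.
apply: eq_bigr => z /andP[lexz ltzy].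
have lt_itv : (#|itv x z| < #|itv x y|)%N.
  apply/proper_card/properP; split.
    by apply/fintype.subsetP => t; rewrite !inE => /andP[-> /lt_trans->].
  by exists z; rewrite !inE ?lexz ?ltzy ?ltxx.
apply: IHn; exact: leq_trans lt_itv _.
Qed.

Lemma mobius_xx x : mobius x x = 1%R.
Proof. by rewrite /mobius /= eqxx. Qed.

Lemma mobius_lt x y : x < y ->
  mobius x y = (- \sum_(z | (x <= z < y)%O) mobius x z)%R.
Proof.
move=> ltxy; rewrite {1}/mobius /= (lt_eqF ltxy) ltxy; congr (- _)%R.
apply: eq_bigr => z /andP[lexz ltzy]; apply: mobius_rec_stable.
  apply/proper_card/properP; split; first exact: subset_predT.
  by exists z; rewrite !inE ?ltxx ?andbF.
exact: max_card.
Qed.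

Lemma mobius_nle x y : ~~ (x <= y) -> mobius x y = 0%R.
Proof.
rewrite le_eqVlt negb_or => /andP[/negPf nxy /negPf nlt].
by rewrite /mobius /= nxy nlt.
Qed.

End Mobius.

(* A central arrangement is a finite family alpha of linear forms on R^d, with
   hyperplanes lker (alpha i); the sign of alpha i fixes the labelling of the
   two open half-spaces. The definitions below do not need the forms to be
   nonzero or the hyperplanes to be distinct. *)
Section Arrangement.
Context {R : realType} {d : nat} {I : finType}.
Variable alpha : I -> 'Hom('rV[R]_d, R^o).
Local Open Scope classical_set_scope.

Definition hyperplane (i : I) : {vspace 'rV[R]_d} := lker (alpha i).

(* Signs +, -, 0 are Some true, Some false, None. *)
Definition half_space (i : I) (s : option bool) : set 'rV[R]_d :=
  match s with
  | Some true => [set v | 0 < (alpha i v : R)]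
  | Some false => [set v | (alpha i v : R) < 0]
  | None => [set v | v \in hyperplane i]
  end.

Definition cell (s : I -> option bool) : set 'rV[R]_d :=
  \bigcap_(i in [set: I]) half_space i (s i).

(* A face, being a nonempty cell, is determined by its signs (cell_inj), which
   represent it here. *)
Record face : Type := Face {
  face_sign : {ffun I -> option bool};
  face_signP : `[< cell face_sign !=set0 >] }.

HB.instance Definition _ := [isSub for face_sign].
HB.instance Definition _ := [Finite of face by <:].

Definition face_set (x : face) : set 'rV[R]_d := cell (face_sign x).

Definition sign_at (i : I) (v : 'rV[R]_d) : option bool :=
  if (alpha i v : R) == 0 then None else Some (0 < (alpha i v : R)).

Lemma half_spaceE i s v : half_space i s v <-> sign_at i v = s.
Proof.
rewrite /half_space /sign_at /hyperplane; case: s => [[]|] /=.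
- case: ltgtP => // _; split=> //.
- case: ltgtP => // _; split=> //.
- by rewrite memv_ker; case: ifP => _; split.
Qed.

Lemma cellE s v : cell s v <-> forall i, sign_at i v = s i.
Proof.
by split=> [cv i|cv i _]; [apply/half_spaceE/cv|apply/half_spaceE/cv].
Qed.

Lemma cell_inj (x y : face) : face_set x = face_set y -> x = y.
Proof.
move=> exy; apply/val_inj/ffunP => i /=.
have /asboolP[v xv] := face_signP x.
have yv : face_set y v by rewrite -exy.
have [/(_ xv) <- _] := cellE (face_sign x) v.
by have [/(_ yv) <- _] := cellE (face_sign y) v.
Qed.

Definition face_one_sign : {ffun I -> option bool} := [ffun=> None].

Fact face_one_subproof : `[< cell face_one_sign !=set0 >].
Proof.
apply/asboolP; exists 0; apply/cellE => i.
by rewrite ffunE /sign_at linear0 eqxx.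
Qed.

Definition face_one : face := Face face_one_subproof.

Definition face_mul_sign (x y : face) : {ffun I -> option bool} :=
  [ffun i => if face_sign x i is Some s then Some s else face_sign y i].

Fact face_mul_subproof x y : `[< cell (face_mul_sign x y) !=set0 >].
Proof.
have /asboolP[v /cellE xv] := face_signP x.
have /asboolP[w /cellE yw] := face_signP y.
apply/asboolP.
have [eps eps0 small] : exists2 eps : R, 0 < eps & forall i,
    (alpha i v : R) != 0 -> eps * `|alpha i w : R| < `|alpha i v : R|.
  suff [eps eps0 small] : exists2 eps : R, 0 < eps & forall i, i \in enum I ->
      (alpha i v : R) != 0 -> eps * `|alpha i w : R| < `|alpha i v : R|.
    by exists eps => // i; apply: small; rewrite mem_enum.
  elim: (enum I) => [|i s [eps eps0 small]]; first by exists 1.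
  have [av0|av0] := eqVneq (alpha i v : R) 0.
    exists eps => // j; rewrite inE => /predU1P[->|/small//].
    by rewrite av0 eqxx.
  pose eta := `|alpha i v : R| / (`|alpha i w : R| + 1).
  have w1 : 0 < `|alpha i w : R| + 1 by rewrite ltr_wpDl.
  have eta0 : 0 < eta by rewrite divr_gt0 ?normr_gt0.
  exists (Num.min eps eta); first by rewrite lt_min eps0 eta0.
  move=> j; rewrite inE => /predU1P[->|js] aj0.
    apply: (@le_lt_trans _ _ (eta * `|alpha i w : R|)).
      by rewrite ler_wpM2r // ge_min lexx orbT.
    rewrite /eta mulrAC ltr_pdivrMr // ltr_pM2l ?normr_gt0 //.
    by rewrite ltrDl.
  apply: le_lt_trans (small j js aj0).
  by rewrite ler_wpM2r // ge_min lexx.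
exists (v + eps *: w); apply/cellE => i; rewrite ffunE -xv -yw /sign_at.
rewrite linearD linearZ /= /GRing.scale /=.
set a : R := alpha i v; set b : R := alpha i w.
have [a0|a0] := eqVneq a 0.
  by rewrite a0 add0r mulf_eq0 gt_eqF //= pmulr_rgt0.
have := small i a0; rewrite -/a -/b => lt_ab.
have {lt_ab} : `|eps * b| < `|a| by rewrite normrM gtr0_norm.
have [a_gt0|a_lt0|/eqP] := ltgtP a 0; last by rewrite (negPf a0).
- rewrite ltr_norml ltr0_norm // opprK => /andP[_ h].
  have s0 : a + eps * b < 0 by rewrite addrC -ltrBrDr sub0r.
  by rewrite lt_eqF // ltNge ltW.
- rewrite ltr_norml gtr0_norm // => /andP[h _].
  have s0 : 0 < a + eps * b by rewrite addrC -ltrBlDr sub0r.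
  by rewrite gt_eqF // s0.
Qed.

Definition face_mul (x y : face) : face := Face (face_mul_subproof x y).

Lemma face_mulE x y i :
  face_sign (face_mul x y) i =
    if face_sign x i is Some s then Some s else face_sign y i.
Proof. exact: ffunE. Qed.

Lemma face_oneE i : face_sign face_one i = None.
Proof. exact: ffunE. Qed.

Fact face_mulA : associative face_mul.
Proof.
move=> x y z; apply/val_inj/ffunP => i.
by rewrite [LHS]face_mulE [RHS]face_mulE !face_mulE; case: (face_sign x i).
Qed.

Fact face_mul1 : left_id face_one face_mul.
Proof.
by move=> x; apply/val_inj/ffunP => i; rewrite [LHS]face_mulE face_oneE.
Qed.

Fact face_mulr1 : right_id face_one face_mul.
Proof.
move=> x; apply/val_inj/ffunP => i; rewrite [LHS]face_mulE face_oneE.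
by rewrite -[RHS]/(face_sign x i); case: (face_sign x i).
Qed.

HB.instance Definition _ :=
  Monoid.isLaw.Build face face_one face_mul face_mulA face_mul1 face_mulr1.

Definition supp (x : face) : {vspace 'rV[R]_d} :=
  (\bigcap_(i | face_sign x i == None) hyperplane i)%VS.

Definition flat : Type := seq_sub (codom supp).

HB.instance Definition _ := Finite.on flat.
HB.instance Definition _ := [isSub of flat for @ssval _ (codom supp)].

Definition flat_le (X Y : flat) : bool := (ssval X <= ssval Y)%VS.

Fact flat_disp : Order.disp_t. Proof. exact: Order.Disp tt tt. Qed.

Fact flat_le_refl : reflexive flat_le.
Proof. by move=> X; apply: subvv. Qed.

Fact flat_le_anti : antisymmetric flat_le.
Proof. by move=> X Y ?; apply/val_inj/subv_anti. Qed.

Fact flat_le_trans : transitive flat_le.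
Proof. by move=> Y X Z; apply: subv_trans. Qed.

HB.instance Definition _ := Order.Le_isPOrder.Build flat_disp flat
  flat_le_refl flat_le_anti flat_le_trans.

End Arrangement.

Definition face_alg (k : fieldType) (R : realType) (d : nat) (I : finType)
    (alpha : I -> 'Hom('rV[R]_d, R^o)) : falgType k :=
  monoid_alg k (@face_mul R d I alpha).

Definition face_elt (k : fieldType) (R : realType) (d : nat) (I : finType)
    (alpha : I -> 'Hom('rV[R]_d, R^o)) (x : face alpha) : face_alg k alpha :=
  alg_of x.

(* Main.v *)
Require Import Defs.
From HB Require Import structures.
From mathcomp Require Import all_boot all_order all_algebra all_fingroup all_field.
From mathcomp Require Import boolp classical_sets reals.

Set Implicit Arguments.
Unset Strict Implicit.
Unset Printing Implicit Defensive.

Import Order.TTheory GRing.Theory Num.Theory.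
Local Open Scope ring_scope.

(** The idea is to count the faces above a given face in two ways.

    Algebra. Let [A] be the semigroup algebra. If [supp y] is not below [X], then [y e_X = 0] (alg_of_e_eq0);
    if it is, then [e_X y = e_X] (alg_of_e_small). This makes the [e_X] a
    complete system of orthogonal idempotents, primitive because every corner
    [e_X A e_X] is the line of [e_X]. A homomorphism [A e_X -> A e_Y] is right
    multiplication by an element of [e_X A e_Y], so the Cartan invariant is
    [c(X,Y) = dim e_X A e_Y] (dim_homA). For a face [z] of support [Z], the
    space [z A e_Y] has as basis the [y e_Y] with [zy = y] and [supp y = Y]
    (dim_rep_corner). On the other hand [z A] is isomorphic, as a right ideal,
    to the one generated by the sum of the [e_X] with [X >= Z]. Hence
    (card_faces_above)
<<
      #{y | zy = y, supp y = Y} = sum_(X >= Z) c(X,Y).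
>>

    Geometry. If [Z <= Y], the faces [y] with [zy = y] and [supp y <= Y] are in
    correspondence with the faces, inside [Y], of the hyperplanes that contain
    [z]. Adding hyperplanes one at a time does not change the alternating sum
    of the [(-1)^dim] of the supports: a hyperplane that cuts a face of
    dimension [n] replaces it by two faces of dimension [n] and one of dimension
    [n - 1] (fiber_euler). With no hyperplane there is one face, the whole of
    [Y], so the sum is [(-1)^(dim Y)] (face_above_euler).

    Together they give [sum_(Z <= X <= Y) (-1)^(dim X) c(Z,X) = 0] for [Z < Y]
    (signed_row_sum), which is the recursion of the Moebius function for
    [(-1)^(dim Z + dim X) c(Z,X)]. As [c] is a dimension it is nonnegative, so
    it equals [|mu|]. Triangularity follows by listing the flats by decreasing
    dimension. *)

(** * Induction in a finite poset *)

Section PosetInduction.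
Context {disp : Order.disp_t} {L : finPOrderType disp}.

Lemma finposet_gt_ind (P : L -> Prop) :
  (forall X, (forall Y, (X < Y)%O -> P Y) -> P X) -> forall X, P X.
Proof.
move=> IH X; have [n] := ubnP #|[pred Y | (X < Y)%O]|.
elim: n X => // n IHn X ltn; apply: IH => Y XY; apply: IHn.
rewrite ltnS in ltn; apply: (leq_trans _ ltn).
apply/proper_card/properP; split.
  by apply/fintype.subsetP => Z; rewrite !inE; apply: lt_trans.
by exists Y; rewrite !inE ?ltxx.
Qed.

End PosetInduction.

Lemma finposet_lt_ind (disp : Order.disp_t) (L : finPOrderType disp)
    (P : L -> Prop) :
  (forall X, (forall Y, (Y < X)%O -> P Y) -> P X) -> forall X, P X.
Proof. exact: (@finposet_gt_ind _ L^d). Qed.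

(** * Peirce corners of an algebra *)

Section PeirceCorners.
Context {k : fieldType} {A : falgType k}.
Implicit Types a b p q u : A.

Definition corner a b : {vspace A} := limg (amulr b \o amull a)%VF.

Lemma cornerP a b u : reflect (exists v, u = a * v * b) (u \in corner a b).
Proof.
apply: (iffP memv_imgP) => [[v _ ->]|[v ->]]; exists v.
- by rewrite comp_lfunE !lfunE.
- exact: memvf.
- by rewrite comp_lfunE !lfunE.
Qed.

(** A homomorphism out of [A p] is determined by the image [u] of [p], and
    [u = p u] since [p] is idempotent; conversely right multiplication by any
    element of [p A b] is a homomorphism into [A b]. *)
Lemma dim_homA p b : p * p = p ->
  \dim (homA (left_ideal p) (left_ideal b)) = \dim (corner p b).
Proof.
move=> pp; set U := left_ideal p; set V := left_ideal b.
have pU : p \in U by apply/left_idealP; exists 1; rewrite mul1r.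
have closed_U a u : u \in U -> a * u \in U by exact: left_ideal_closed.
pose g := vsproj U p.
have gE : vsval g = p by rewrite vsprojK.
pose ev (f : 'Hom(subvs_of U, subvs_of V)) : A := vsval (f g).
have ev_lin : linear ev.
  by move=> c f1 f2; rewrite /ev add_lfunE scale_lfunE linearP.
pose evL := GRing.isLinear.Build k _ A _ ev ev_lin.
pose evl : {linear _ -> A} := HB.pack ev evL.
have homE f : f \in homA U V ->
      forall u : subvs_of U, vsval (f u) = vsval u * ev f.
  move=> /(homAP _ closed_U) fA u; apply: fA; rewrite gE.
  by have /left_idealP[a ->] := subvsP u; rewrite -mulrA pp.
have <- : (linfun evl @: homA U V)%VS = corner p b.
  apply/vspaceP => w; apply/memv_imgP/cornerP => [[f fA ->]|[v ->]].
    rewrite lfunE /=; have := homE f fA g; rewrite gE -[vsval (f g)]/(ev f).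
    have /left_idealP[v ->] : ev f \in V by exact: subvsP.
    by move=> vE; exists v; rewrite {1}vE mulrA.
  pose h (u : subvs_of U) := vsproj V (vsval u * (p * v * b)).
  have h_lin : linear h.
    by move=> c u1 u2; rewrite /h linearP mulrDl -scalerAl linearP.
  pose hL := GRing.isLinear.Build k _ (subvs_of V) _ h h_lin.
  pose hl : {linear _ -> subvs_of V} := HB.pack h hL.
  have hE (u : subvs_of U) : vsval (linfun hl u) = vsval u * (p * v * b).
    rewrite lfunE /= vsprojK //; apply/left_idealP.
    by exists (vsval u * (p * v)); rewrite !mulrA.
  exists (linfun hl).
    by apply/(homAP _ closed_U) => a u u2 u2E; rewrite !hE u2E -mulrA.
  by rewrite lfunE /= /ev hE gE !mulrA pp.
apply/esym/limg_dim_eq/eqP; rewrite -subv0; apply/subvP => f.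
rewrite memv_cap memv_ker lfunE /= memv0 => /andP[fA /eqP f0].
apply/eqP/lfunP => u; apply/val_inj; rewrite /= zero_lfunE.
by have := homE f fA u; rewrite f0 mulr0 => ->; rewrite linear0.
Qed.

(** Left multiplication by [q] maps [p A b] onto [q A b], with inverse left
    multiplication by [p]: the right ideals [p A] and [q A] are isomorphic. *)
Lemma dim_corner_eq p q b : p * p = p -> p * q = p -> q * p = q ->
  \dim (corner p b) = \dim (corner q b).
Proof.
move=> pp pq qp.
have <- : (amull q @: corner p b)%VS = corner q b.
  apply/vspaceP => w; apply/memv_imgP/cornerP => [[u /cornerP[v ->] ->]|[v ->]].
    by exists v; rewrite lfunE /= !mulrA qp.
  exists (p * v * b); first by apply/cornerP; exists v.
  by rewrite lfunE /= !mulrA qp.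
apply/esym/limg_dim_eq/eqP; rewrite -subv0; apply/subvP => u.
rewrite memv_cap memv_ker lfunE /= memv0 => /andP[/cornerP[v ->] /eqP qu0].
have -> : p * v * b = p * (q * (p * v * b)) by rewrite !mulrA pq pp.
by rewrite qu0 mulr0.
Qed.

(** Left multiplication by [e i] projects [(sum e) A b] onto [e i A b], which
    makes the sum of the corners direct. *)
Lemma dim_corner_sum (I : finType) (P : pred I) (e : I -> A) b :
  (forall i, e i * e i = e i) -> (forall i j, i != j -> e i * e j = 0) ->
  \dim (corner (\sum_(i | P i) e i) b) =
    (\sum_(i | P i) \dim (corner (e i) b))%N.
Proof.
move=> ee e0.
have eP i u : u \in corner (e i) b -> e i * u = u.
  by case/cornerP => v ->; rewrite !mulrA ee.
have e_out i j u : i != j -> u \in corner (e j) b -> e i * u = 0.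
  by move=> ij /cornerP[v ->]; rewrite !mulrA e0 // !mul0r.
have -> : corner (\sum_(i | P i) e i) b = (\sum_(i | P i) corner (e i) b)%VS.
  apply/vspaceP => u; apply/idP/idP => [/cornerP[v ->]|/memv_sumP[us usP ->]].
    rewrite !mulr_suml; apply: memv_sumr => i Pi; apply/cornerP.
    by exists v.
  apply: memv_suml => i Pi; have /cornerP[v ->] := usP i Pi.
  apply/cornerP; exists (e i * v); rewrite mulrA mulr_suml (bigD1 i) //= ee.
  by rewrite big1 ?addr0 // => j /andP[_ /e0].
suff /directvP -> : directv (\sum_(i | P i) corner (e i) b) by [].
apply/directv_sum_independent => us usP us0 i Pi.
have := congr1 (fun u => e i * u) us0.
rewrite mulr0 mulr_sumr (bigD1 i) //= eP ?usP // big1 ?addr0 // => j /andP[Pj ji].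
by rewrite (e_out i j) ?usP // eq_sym.
Qed.

End PeirceCorners.

(** * Idempotents of a monoid whose supports form a poset *)

Section SupportedMonoid.
Context {disp : Order.disp_t} {L : finPOrderType disp}.

Context {k : fieldType} {M : finType} {one : M} {op : Monoid.law one}.
Local Notation kM := (monoid_alg k op).
Local Notation "[ w ]" := (alg_of w : kM).

(* The two laws say that M is a left regular band and that [sup] is its
   support map, sending products to joins. *)
Variable sup : M -> L.
Hypothesis sup_le : forall a b, (sup a <= sup b)%O = (op b a == b).
Hypothesis sup_join : forall a b X,
  (sup (op a b) <= X)%O = (sup a <= X)%O && (sup b <= X)%O.

Variables (x : L -> M) (e : L -> kM).
Hypothesis sup_x : forall X, sup (x X) = X.
Hypothesis e_rec : forall X,
  e X = [x X] - \sum_(Y | (X < Y)%O) [x X] * e Y.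

Lemma op_absorb a b : (sup a <= sup b)%O -> op b a = b.
Proof. by rewrite sup_le => /eqP. Qed.

Lemma op_idem a : op a a = a.
Proof. exact: op_absorb. Qed.

Lemma sup_opl a b : (sup a <= sup (op a b))%O.
Proof. by have := sup_join a b (sup (op a b)); rewrite lexx => /esym/andP[]. Qed.

Lemma sup_opr a b : (sup b <= sup (op a b))%O.
Proof. by have := sup_join a b (sup (op a b)); rewrite lexx => /esym/andP[]. Qed.

Lemma alg_ofMl_coef a (u : kM) w :
  ([a] * u) w = \sum_(t | op a t == w) u t.
Proof.
rewrite [LHS]monoid_alg_mulE (bigD1 a) //= [X in _ + X]big1 ?addr0; last first.
  by move=> b ba; rewrite big1 // => t _; rewrite ffunE (negPf ba) !mul0r.
rewrite [RHS]big_mkcond /=; apply: eq_bigr => t _.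
by rewrite ffunE eqxx mul1r; case: eqP; rewrite ?mulr1 ?mulr0.
Qed.

Lemma alg_ofMl_eq0 a (u : kM) w : ~~ (sup a <= sup w)%O -> ([a] * u) w = 0.
Proof.
move=> aw; rewrite alg_ofMl_coef big1 // => t /eqP tw.
by case/negP: aw; rewrite -tw sup_opl.
Qed.

(** The elements occurring in [e X] all have support at least [X], so they absorb
    [w] on the right. *)
Lemma alg_of_e_small w X : (sup w <= X)%O -> e X * [w] = e X.
Proof.
elim/(@finposet_gt_ind _ L): X => X IH wX.
rewrite e_rec mulrBl -alg_ofM op_absorb ?sup_x // mulr_suml.
by congr (_ - _); apply: eq_bigr => Y XY; rewrite -mulrA IH // (le_trans wX) // ltW.
Qed.

(** With [v = w (x X)] and [W] its support, which is larger than [X], the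
    definition of [e X] gives [w e_X = v - sum_(Y > X) v e_Y]. By induction only
    the [Y >= W] contribute, and the recursion for [e_W] says exactly that
    [v = sum_(Y >= W) v e_Y]. *)
Lemma alg_of_e_eq0 w X : ~~ (sup w <= X)%O -> [w] * e X = 0.
Proof.
elim/(@finposet_gt_ind _ L): X w => X IH w wX.
set v := op w (x X); set W := sup v.
have XW : (X < W)%O.
  rewrite lt_neqAle -{2}(sup_x X) sup_opr andbT; apply: contra wX => /eqP XW.
  by rewrite XW sup_opl.
rewrite e_rec mulrBr mulr_sumr -alg_ofM -/v.
under eq_bigr => Y _ do rewrite mulrA -alg_ofM -/v.
rewrite (bigID (fun Y => W <= Y)%O) /= [X in _ - (_ + X)]big1 ?addr0; last first.
  by move=> Y /andP[XY vY]; rewrite IH.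
rewrite (bigD1 W) /=; last by rewrite XW lexx.
have -> : [v] * e W = [v] - \sum_(Y | (W < Y)%O) [v] * e Y.
  rewrite e_rec mulrBr mulr_sumr -alg_ofM op_absorb ?sup_x //.
  by congr (_ - _); apply: eq_bigr => Y _; rewrite mulrA -alg_ofM op_absorb ?sup_x.
rewrite [X in _ - (_ + X)](_ : _ = \sum_(Y | (W < Y)%O) [v] * e Y).
  by rewrite subrK subrr.
apply: eq_bigl => Y.
rewrite [RHS]lt_neqAle [Y == W]eq_sym.
by case: (boolP (W <= Y)%O) => WY; rewrite ?andbF // (lt_le_trans XW WY) !andbT.
Qed.

Lemma e_rep X : [x X] * e X = e X.
Proof.
by rewrite {1}e_rec mulrBr -alg_ofM op_idem mulr_sumr e_rec;
  under eq_bigr do rewrite mulrA -alg_ofM op_idem.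
Qed.

Lemma alg_of_mul_e_eq0 z (u : kM) X : ~~ (sup z <= X)%O -> [z] * u * e X = 0.
Proof.
move=> zX; rewrite [u]monoid_alg_sum mulr_sumr mulr_suml big1 // => w _.
rewrite -scalerAr -scalerAl -alg_ofM alg_of_e_eq0 ?scaler0 //.
by apply: contra zX; apply: le_trans; exact: sup_opl.
Qed.

Lemma e_mul_e_eq0 X Y (u : kM) : ~~ (X <= Y)%O -> e X * u * e Y = 0.
Proof.
by move=> XY; rewrite -e_rep -[_ * _ * u]mulrA alg_of_mul_e_eq0 ?sup_x.
Qed.

Lemma e_idem X : e X * e X = e X.
Proof.
rewrite {1}e_rec mulrBl e_rep mulr_suml big1 ?subr0 // => Y XY.
by rewrite -mulrA -[e Y]mulr1 e_mul_e_eq0 ?mulr0 // lt_geF.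
Qed.

Lemma e_orth X Y : X != Y -> e X * e Y = 0.
Proof.
elim/(@finposet_gt_ind _ L): X => X IH XY.
have [leXY|] := boolP (X <= Y)%O; last first.
  by move=> nXY; rewrite -[e X]mulr1 e_mul_e_eq0.
have ltXY : (X < Y)%O by rewrite lt_neqAle XY.
rewrite e_rec mulrBl mulr_suml (bigD1 Y) //= -mulrA e_idem big1 ?addr0 ?subrr //.
by move=> Z /andP[XZ ZY]; rewrite -mulrA IH ?mulr0.
Qed.

(** The smallest support is that of [one], whose only representative is [one];
    there the recursion reads [e_0 = 1 - sum_(Y > 0) e_Y]. *)
Lemma e_sum : \sum_X e X = 1.
Proof.
have sup1_min X : (sup one <= X)%O by rewrite -(sup_x X) sup_le Monoid.mulm1.
have x1 : x (sup one) = one.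
  by rewrite -[LHS](Monoid.mul1m op); apply/op_absorb; rewrite sup_x.
rewrite (bigD1 (sup one)) //= {1}e_rec x1 alg_of1 -mulr_sumr mul1r.
rewrite -addrA -[RHS]addr0; congr (_ + _); apply/eqP.
rewrite addrC subr_eq0; apply/eqP/eq_bigl => X.
by rewrite lt_neqAle eq_sym sup1_min andbT.
Qed.

(** The coefficients of [y e_(sup y)] at the elements of the same support as
    [y] are those of [y]: the corrections only involve larger supports. *)
Lemma alg_of_e_coef y w Y :
  sup y = Y -> sup w = Y -> ([y] * e Y) w = (w == y)%:R.
Proof.
move=> yY wY; rewrite e_rec mulrBr -alg_ofM op_absorb ?sup_x ?yY //.
rewrite mulr_sumr !ffunE sum_ffunE big1 ?subr0 // => Z YZ.
rewrite -e_rep !mulrA -!alg_ofM alg_ofMl_eq0 // wY.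
apply/negP => le_Y; suff: (Y < Y)%O by rewrite ltxx.
by apply: (lt_le_trans YZ); apply: le_trans le_Y; rewrite -{1}(sup_x Z) sup_opr.
Qed.

Lemma e_corner_scalar X (u : kM) : exists c : k, e X * u * e X = c *: e X.
Proof.
exists (\sum_(w | (sup w <= X)%O) u w).
rewrite {1}[u]monoid_alg_sum mulr_sumr mulr_suml scaler_suml.
rewrite [RHS]big_mkcond /=; apply: eq_bigr => w _.
rewrite -scalerAr -scalerAl; case: ifP => wX.
  by rewrite alg_of_e_small // e_idem.
by rewrite -mulrA alg_of_e_eq0 ?wX // mulr0 scaler0.
Qed.

(** Summands [f], [g] of [e X] satisfy [f = e_X f e_X], so [f] is an idempotent
    multiple of [e X]: the scalar is 0 or 1. *)
Lemma e_primitive X : primitive_idempotent (e X).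
Proof.
split=> [||f g ff gg fg gf def_e]; first exact: e_idem.
  apply/eqP => eX0; have := alg_of_e_coef (sup_x X) (sup_x X).
  by rewrite eX0 mulr0 ffunE eqxx => /eqP; rewrite eq_sym oner_eq0.
have [c cE] := e_corner_scalar X f.
have fE : f = c *: e X.
  by rewrite -cE def_e mulrDl ff gf addr0 mulrDr ff fg addr0.
have /eqP cc0 : (c * c - c) *: e X = 0.
  have -> : (c * c - c) *: e X = f * f - f.
    by rewrite fE -scalerAl -scalerAr e_idem scalerA scalerBl.
  by rewrite ff subrr.
have [c0|c0] := eqVneq c 0; [by left; rewrite fE c0 scale0r | right].
move: cc0; rewrite scaler_eq0 subr_eq0 => /orP[/eqP cc|/eqP eX0].
  have c1 : c = 1 by apply: (mulfI c0); rewrite mulr1.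
  by apply: (addrI f); rewrite addr0 -def_e fE c1 scale1r.
by move: def_e; rewrite fE eX0 scaler0 add0r => <-.
Qed.

Lemma e_complete : complete_system e.
Proof. by split; [exact: e_primitive | exact: e_orth | exact: e_sum]. Qed.

Definition cdim X Y := \dim (corner (e X) (e Y)).

Lemma cdim_eq0 X Y : ~~ (X <= Y)%O -> cdim X Y = 0%N.
Proof.
move=> XY; apply/eqP; rewrite dimv_eq0 -subv0; apply/subvP => u.
by case/cornerP => v ->; rewrite e_mul_e_eq0 ?mem0v.
Qed.

(** The [y e_Y] with [z y = y] and [sup y = Y] form a basis: they are
    independent by [alg_of_e_coef], and they span because [z w e_Y] is either 0
    or [y e_Y] with [y = z w (x Y)]. *)
Lemma dim_rep_corner z Y :
  \dim (corner [z] (e Y)) = #|[set y | (op z y == y) && (sup y == Y)]|.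
Proof.
set G := [set y | _]; pose b i := [@enum_val _ (mem G) i] * e Y.
pose B : #|G|.-tuple kM := [tuple b i | i < #|G|].
have Gi i : op z (@enum_val _ (mem G) i) = enum_val i /\
    sup (@enum_val _ (mem G) i) = Y.
  by have := enum_valP i; rewrite inE => /andP[/eqP ? /eqP].
have BE (i : 'I_#|G|) : B`_i = b i by rewrite -tnth_nth tnth_mktuple.
have freeB : free B.
  apply/freeP => c c0 i; have := congr1 (fun u : kM => u (enum_val i)) c0.
  rewrite ffunE sum_ffunE (bigD1 i) //= big1 ?addr0.
    rewrite ffunE BE /b alg_of_e_coef ?(Gi i).2 // eqxx => <-.
    by rewrite /GRing.scale /= mulr1.
  move=> j ji; rewrite ffunE BE /b alg_of_e_coef ?(Gi i).2 ?(Gi j).2 //.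
  by rewrite (inj_eq enum_val_inj) eq_sym (negPf ji) scaler0.
have <- : <<B>>%VS = corner [z] (e Y).
  apply/eqP; rewrite eqEsubv; apply/andP; split.
    apply/span_subvP => u /tnthP[i ->]; rewrite tnth_mktuple /b.
    by apply/cornerP; exists [enum_val i]; rewrite -alg_ofM (Gi i).1.
  apply/subvP => u /cornerP[v ->].
  rewrite [v]monoid_alg_sum mulr_sumr mulr_suml; apply: memv_suml => w _.
  rewrite -scalerAr -scalerAl; apply: memvZ; rewrite -alg_ofM.
  have [zwY|zwY] := boolP (sup (op z w) <= Y)%O; last first.
    by rewrite alg_of_e_eq0 ?mem0v.
  rewrite -e_rep mulrA -alg_ofM; set y := op _ _.
  have yG : y \in G.
    have zy : op z y = y by rewrite /y !Monoid.mulmA /= op_idem.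
    rewrite inE zy eqxx eq_le.
    by rewrite sup_join zwY sup_x lexx -{1}(sup_x Y) sup_opr.
  suff -> : [y] * e Y = tnth B (enum_rank_in yG y).
    by rewrite memv_span ?mem_tnth.
  by rewrite tnth_mktuple /b enum_rankK_in.
by rewrite (eqP freeB) size_tuple.
Qed.

(** [z] and the sum [E] of the [e X] with [sup z <= X] generate isomorphic right
    ideals: [z E = z] since [z e_X = 0] for the other [X], and [E z = E]. *)
Lemma card_faces_above z Y :
  #|[set y | (op z y == y) && (sup y == Y)]| =
  (\sum_(X | (sup z <= X)%O) cdim X Y)%N.
Proof.
rewrite -dim_rep_corner -(dim_corner_sum _ _ e_idem e_orth).
apply: dim_corner_eq.
- by rewrite -alg_ofM op_idem.
- rewrite -[RHS]mulr1 -e_sum [in RHS](bigID (fun X => sup z <= X)%O) /= mulrDr.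
  rewrite [X in _ = _ + X]mulr_sumr [X in _ = _ + X]big1 ?addr0 // => X zX.
  exact: alg_of_e_eq0.
- by rewrite mulr_suml; apply: eq_bigr => X zX; rewrite alg_of_e_small.
Qed.

End SupportedMonoid.

(** * From the Euler relation to the Moebius function *)

Section MobiusInversion.
Context {disp : Order.disp_t} {L : finPOrderType disp}.

(* For the face semigroup, [s X] is [(-1) ^ dim X], [c] is the Cartan matrix and
   the inner sum of [euler] is the number of faces of support [X] that lie above
   a fixed face of support [Z]. *)
Variables (c : L -> L -> nat) (s : L -> int).
Hypothesis s_sq : forall X, s X * s X = 1.
Hypothesis c_le : forall X Y : L, ~~ (X <= Y)%O -> c X Y = 0%N.
Hypothesis euler : forall Z Y : L, (Z <= Y)%O ->
  \sum_(X | (X <= Y)%O) s X * (\sum_(W | (Z <= W)%O) c W X)%N%:Z = s Y.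

(** Exchanging the sums in [euler] gives the sums over [W >= Z] of the left-hand
    sides [g W]; these sums equal [s Y] for every [Z <= Y], which determines [g]
    by descending induction. *)
Lemma signed_row_sum (Z Y : L) :
  \sum_(X | (X <= Y)%O) s X * (c Z X)%:Z = if Z == Y then s Y else 0.
Proof.
elim/(@finposet_gt_ind _ L): Z => Z IH.
have [ZY|nZY] := boolP (Z <= Y)%O; last first.
  rewrite ifF; last by apply: contraNF nZY => /eqP->.
  rewrite big1 // => X XY; rewrite c_le ?mulr0 //.
  by apply: contra nZY => /le_trans; apply.
have := euler ZY.
under eq_bigr => X _ do rewrite (big_morph Posz PoszD (erefl _)) mulr_sumr.
rewrite exchange_big /= (bigD1 Z) //=.
set S := (X in _ + X); have -> : S = if Z == Y then 0 else s Y.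
  rewrite /S (eq_bigr (fun W => if W == Y then s Y else 0)); last first.
    by move=> W /andP[ZW WZ]; rewrite IH // lt_neqAle eq_sym WZ.
  have [->|nZY] := eqVneq Z Y.
    by rewrite big1 // => W /andP[_ /negPf->].
  rewrite (bigD1 Y) /=; last by rewrite ZY eq_sym.
  by rewrite eqxx big1 ?addr0 // => W /andP[_ /negPf->].
by case: eqP => _; rewrite ?addr0 // => /eqP; rewrite -subr_eq0 addrK => /eqP.
Qed.

Lemma signed_mobius (X Y : L) : s X * s Y * (c X Y)%:Z = mobius X Y.
Proof.
elim/(@finposet_lt_ind _ L): Y => Y IH.
have [XY|nXY] := boolP (X <= Y)%O; last by rewrite c_le // mulr0 mobius_nle.
have := signed_row_sum X Y; rewrite (bigD1 Y) //=.
have [<-|neXY] := eqVneq X Y.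
  rewrite big1 ?addr0 => [sc|Z /andP[ZX nZ]].
    by rewrite mobius_xx -mulrA sc s_sq.
  rewrite c_le ?mulr0 //; apply: contra nZ => XZ.
  by rewrite eq_le ZX.
have ltXY : (X < Y)%O by rewrite lt_neqAle neXY.
move/eqP; rewrite addr_eq0 => /eqP scE.
rewrite mobius_lt // -mulrA scE mulrN mulr_sumr; congr (- _).
rewrite (bigID (fun Z => X <= Z)%O) /= [X in _ + X]big1 ?addr0; last first.
  by move=> Z /andP[_ XZ]; rewrite c_le ?mulr0.
apply: eq_big => [Z|Z /andP[/andP[ZY nZY] _]].
  by rewrite [in RHS]lt_neqAle andbC [(Z <= Y)%O && _]andbC.
by rewrite mulrA IH // lt_neqAle nZY.
Qed.

Lemma card_mobius X Y : c X Y = `|mobius X Y|%N.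
Proof.
rewrite -signed_mobius !abszM absz_nat.
have s1 Z : `|s Z|%N = 1%N.
  have := congr1 absz (s_sq Z); rewrite abszM => /eqP.
  by rewrite muln_eq1 => /andP[/eqP].
by rewrite !s1 !mul1n.
Qed.

End MobiusInversion.

(** * The Euler relation for the faces of an arrangement *)

Section EulerRelation.
Context {R : realType} {d : nat} {I : finType}.
Variable alpha : I -> 'Hom('rV[R]_d, R^o).
Local Notation face := (face alpha).
Implicit Types (y : face) (J N : {set I}) (sigma tau b : {ffun I -> option bool}).

Definition zeros y : {set I} := [set i | face_sign y i == None].

Definition flat_of N : {vspace 'rV[R]_d} :=
  (\bigcap_(i in N) hyperplane alpha i)%VS.

Lemma flat_ofP N v :
  reflect (forall i, i \in N -> alpha i v = 0) (v \in flat_of N).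
Proof.
rewrite memvE; apply: (iffP subv_bigcapP) => vN i /vN.
  by rewrite -memvE memv_ker => /eqP.
by move=> v0; rewrite -memvE memv_ker v0.
Qed.

Lemma flat_ofU1 i N : flat_of (i |: N) = (hyperplane alpha i :&: flat_of N)%VS.
Proof.
apply/vspaceP => v; rewrite memv_cap.
apply/flat_ofP/andP => [v0|[vi /flat_ofP v0] j].
  rewrite memv_ker v0 ?setU11 //; split=> //.
  by apply/flat_ofP => j jN; rewrite v0 // setU1r.
by rewrite !inE => /predU1P[->|/v0//]; move: vi; rewrite memv_ker => /eqP.
Qed.

Lemma suppE y : supp y = flat_of (zeros y).
Proof. by apply: eq_bigl => i; rewrite inE. Qed.

Lemma face_witness y : exists v, forall i, sign_at alpha i v = face_sign y i.
Proof. by have /asboolP[v /cellE yv] := face_signP y; exists v. Qed.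

Lemma face_of_vec (v : 'rV[R]_d) :
  exists y, forall i, face_sign y i = sign_at alpha i v.
Proof.
have vP : `[< (cell alpha [ffun i => sign_at alpha i v] !=set0)%classic >].
  by apply/asboolP; exists v; apply/cellE => i; rewrite ffunE.
by exists (Face vP) => i; rewrite ffunE.
Qed.

Lemma sign_at_eq0 i v : (sign_at alpha i v == None) = ((alpha i v : R) == 0).
Proof. by rewrite /sign_at; case: ifP. Qed.

Lemma sign_at_pos i v : sign_at alpha i v = Some true <-> 0 < (alpha i v : R).
Proof. by rewrite /sign_at; case: ltgtP. Qed.

Lemma sign_at_neg i v : sign_at alpha i v = Some false <-> (alpha i v : R) < 0.
Proof. by rewrite /sign_at; case: ltgtP. Qed.

Lemma face_opp y : exists y', forall i,
  face_sign y' i = omap negb (face_sign y i).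
Proof.
have [v vy] := face_witness y; have [y' y'E] := face_of_vec (- v).
exists y' => i; rewrite y'E -vy /sign_at.
have -> : alpha i (- v) = - (alpha i v : R) :> R by rewrite linearN.
rewrite oppr_eq0 oppr_gt0; by case: ltgtP.
Qed.

(** Elimination of a hyperplane between two faces on opposite sides of it: the
    segment that joins them crosses the hyperplane, and on it the signs common
    to both faces persist. *)
Lemma face_elim y1 y2 i :
  face_sign y1 i = Some true -> face_sign y2 i = Some false ->
  exists2 y : face, face_sign y i = None &
    forall j, face_sign y1 j = face_sign y2 j -> face_sign y j = face_sign y1 j.
Proof.
have [v v1] := face_witness y1; have [w w2] := face_witness y2.
rewrite -v1 -w2 => /sign_at_pos vi /sign_at_neg wi.
set p : R := alpha i v in vi; set q : R := alpha i w in wi.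
have [y yE] := face_of_vec (p *: w + (- q) *: v).
have uE j : alpha j (p *: w + (- q) *: v) =
    p * (alpha j w : R) + (- q) * (alpha j v : R) :> R.
  by rewrite linearD !linearZ.
have q0 : 0 < - q by rewrite oppr_gt0.
exists y => [|j]; rewrite yE.
  by apply/eqP; rewrite sign_at_eq0 uE mulNr [q * _]mulrC subrr.
rewrite -v1 -w2.
case vj: (sign_at alpha j v) => [[]|] /esym.
- move/sign_at_pos: vj => vj /sign_at_pos wj; apply/sign_at_pos.
  by rewrite uE addr_gt0 // mulr_gt0.
- move/sign_at_neg: vj => vj /sign_at_neg wj; apply/sign_at_neg.
  by rewrite uE -oppr_gt0 opprD -!mulrN addr_gt0 // mulr_gt0 // oppr_gt0.
- move/eqP: vj; rewrite sign_at_eq0 => /eqP vj /eqP.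
  rewrite sign_at_eq0 => /eqP wj.
  by apply/eqP; rewrite sign_at_eq0 uE vj wj !mulr0 addr0.
Qed.

Lemma witness_flat_of y v N : (forall i, sign_at alpha i v = face_sign y i) ->
  (v \in flat_of N) = (N \subset zeros y).
Proof.
move=> vy; apply/flat_ofP/fintype.subsetP => h i iN.
  by rewrite inE -vy sign_at_eq0 h.
by apply/eqP; rewrite -[_ == _]sign_at_eq0 vy; have := h i iN; rewrite inE.
Qed.

(** The sign vector of the face of the subarrangement [J] that contains [y]. Off
    [J] it has the fixed signs [b], not zeros: this way, when [b] is the sign
    vector of a face [z] and [J] its zeros, it is the sign vector of [z y]. *)
Definition mix J b y : {ffun I -> option bool} :=
  [ffun i => if i \in J then face_sign y i else b i].

(** The faces of the subarrangement [J] inside the flat of [N]. *)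
Definition realised J b N := [set mix J b y | y : face & N \subset zeros y].

(** The support, inside the flat of [N], of the face of the subarrangement [J]
    with sign vector [sigma]. *)
Definition sigma_flat J N sigma : {vspace 'rV[R]_d} :=
  flat_of (N :|: [set i in J | sigma i == None]).

Definition set_sign sigma i (s : option bool) : {ffun I -> option bool} :=
  [ffun j => if j == i then s else sigma j].

Lemma dim_flat_cut i N : ~~ (flat_of N <= hyperplane alpha i)%VS ->
  \dim (flat_of N) = (\dim (hyperplane alpha i :&: flat_of N)).+1.
Proof.
move=> nN; rewrite -(limg_ker_dim (alpha i) (flat_of N)) capvC -[RHS]addn1.
congr addn.
apply/eqP; rewrite eqn_leq; apply/andP; split.
  by apply: leq_trans (dimvS (subvf _)) _; rewrite dimvf /dim /=.
rewrite lt0n dimv_eq0; apply: contra nN => /eqP im0; apply/subvP => v vN.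
by rewrite memv_ker -memv0 -im0 memv_img.
Qed.

Lemma sum_option_bool (F : option bool -> int) :
  \sum_s F s = F None + (F (Some true) + F (Some false)).
Proof.
rewrite (bigD1 None) //= (bigD1 (Some true)) //= (bigD1 (Some false)) //=.
rewrite big1 ?addr0 //.
by case=> [[]|].
Qed.

(** The faces [sigma] into which the hyperplane [i] divides the face [tau]. Let
    [W] be the support of [tau]. If [tau] does not meet the hyperplane, it lies
    on one side of it, by [face_elim]. If [W] is inside the hyperplane, [tau]
    stays whole. Otherwise [tau] has a face [y] in the hyperplane, and
    multiplying [y] by a face of [W] that leaves the hyperplane, or by the
    opposite of such a face, reaches both sides; there
    [(-1)^(n-1) + 2 (-1)^n = (-1)^n]. *)
Lemma fiber_euler J b N i tau : i \notin J -> tau \in realised J b N ->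
  \sum_(sigma | (sigma \in realised (i |: J) b N) &&
                (set_sign sigma i (b i) == tau))
     (-1) ^+ \dim (sigma_flat (i |: J) N sigma)
  = (-1) ^+ \dim (sigma_flat J N tau) :> int.
Proof.
move=> iJ tauR.
(* [ok s]: the face [tau] meets the side [s] of the hyperplane [i]. *)
pose ok s := [exists y : face, [&& N \subset zeros y, face_sign y i == s &
  [forall j in J, face_sign y j == tau j]]].
have okP s : reflect (exists y, [/\ N \subset zeros y, face_sign y i = s &
    forall j, j \in J -> face_sign y j = tau j]) (ok s).
  apply: (iffP existsP).
    move=> [y /and3P[Ny /eqP ys /forall_inP yJ]].
    by exists y; split=> // j /yJ/eqP.
  move=> [y [Ny ys yJ]].
  by exists y; rewrite Ny ys eqxx; apply/forall_inP => j /yJ->.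
have [y0 y0N tauE] := imsetP tauR; rewrite inE in y0N.
have taub j : j \notin J -> tau j = b j.
  by move=> jJ; rewrite tauE ffunE (negPf jJ).
have setR s : (set_sign tau i s \in realised (i |: J) b N) = ok s.
  apply/imsetP/okP => [[y yN yE]|[y [yN ys yJ]]].
    rewrite inE in yN; exists y; split=> // [|j jJ].
      by have /ffunP/(_ i) := yE; rewrite !ffunE eqxx setU11.
    have /ffunP/(_ j) := yE; rewrite !ffunE setU1r //.
    by case: eqP jJ iJ => [->->|].
  exists y; rewrite ?inE //; apply/ffunP => j; rewrite !ffunE in_setU1.
  have [->|ji] /= := eqVneq j i; first by rewrite ys.
  by case: ifP => [/yJ->|/negbT/taub].
rewrite (reindex_onto (set_sign tau i) (fun sigma => sigma i)) /=; last first.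
  move=> sigma /andP[_ /eqP <-]; apply/ffunP => j; rewrite !ffunE.
  by case: eqP => // ->.
rewrite (eq_bigl ok) => [|s]; last first.
  rewrite setR ffunE eqxx eqxx andbT.
  suff -> : set_sign (set_sign tau i s) i (b i) = tau by rewrite eqxx andbT.
  by apply/ffunP => j; rewrite !ffunE; case: eqP => // ->; rewrite taub.
set W := sigma_flat J N tau.
have flatS s' : sigma_flat (i |: J) N (set_sign tau i (Some s')) = W.
  congr flat_of; apply/setP => j; rewrite !inE ffunE.
  by have [->|] //= := eqVneq j i; rewrite (negPf iJ).
have flatN : sigma_flat (i |: J) N (set_sign tau i None) =
    (hyperplane alpha i :&: W)%VS.
  rewrite -flat_ofU1; congr flat_of; apply/setP => j; rewrite !inE ffunE.
  by have [->|] //= := eqVneq j i; rewrite ?orbT.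
rewrite big_mkcond sum_option_bool !flatS flatN.
have WP y : N \subset zeros y -> (forall j, j \in J -> face_sign y j = tau j) ->
    (N :|: [set j in J | tau j == None]) \subset zeros y.
  move=> yN yJ; rewrite finset.subUset yN; apply/fintype.subsetP => j.
  by rewrite !inE => /andP[/yJ->].
have [okN|nokN] := boolP (ok None).
  have /okP[y [yN yi yJ]] := okN.
  have [WH|nWH] := boolP (W <= hyperplane alpha i)%VS.
    have nok s' : ok (Some s') = false.
      apply/negbTE/negP => /okP[u [uN ui uJ]]; have [v vu] := face_witness u.
      have : v \in hyperplane alpha i.
        by apply: (subvP WH); rewrite (witness_flat_of _ vu) WP.
      by rewrite memv_ker -[_ == _]sign_at_eq0 vu ui.
    by rewrite !nok !addr0 (capv_idPr WH).
  have [w wW wi] : exists2 w, w \in W & (alpha i w : R) != 0.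
    have /subvPn[w wW wi] := nWH; exists w => //.
    by apply: contra wi => wi; rewrite memv_ker.
  have [u uw] := face_of_vec w; have [u' u'u] := face_opp u.
  have uW : N :|: [set j in J | tau j == None] \subset zeros u.
    by rewrite -(witness_flat_of (v := w)).
  have ui : face_sign u i != None by rewrite uw sign_at_eq0.
  have ok_mul t : N :|: [set j in J | tau j == None] \subset zeros t ->
      ok (face_sign t i).
    rewrite finset.subUset => /andP[tN tJ]; apply/okP; exists (face_mul y t); split.
    - apply/fintype.subsetP => j jN; rewrite inE face_mulE.
      have := fintype.subsetP yN j jN; have := fintype.subsetP tN j jN.
      by rewrite !inE => /eqP-> /eqP->.
    - by rewrite face_mulE yi.
    - move=> j jJ; rewrite face_mulE yJ //; case tauj: (tau j) => [//|].
      by have := fintype.subsetP tJ j; rewrite !inE jJ tauj => /(_ isT)/eqP.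
  have u'W : N :|: [set j in J | tau j == None] \subset zeros u'.
    apply: fintype.subset_trans uW _; apply/fintype.subsetP => j.
    by rewrite !inE u'u => /eqP->.
  have okS s' : ok (Some s').
    have := ok_mul u uW; have := ok_mul u' u'W; rewrite u'u.
    by case: (face_sign u i) ui => [[]|] //=; case: s'.
  rewrite !okS [in RHS](dim_flat_cut nWH) [in LHS](dim_flat_cut nWH).
  by rewrite exprS mulN1r addrA subrr add0r.
rewrite add0r.
have : ok (face_sign y0 i).
  apply/okP; exists y0; split=> // j jJ.
  by rewrite tauE ffunE jJ.
have nboth : ~~ (ok (Some true) && ok (Some false)).
  apply: contra nokN => /andP[/okP[y1 [N1 i1 J1]] /okP[y2 [N2 i2 J2]]].
  have [y yi yE] := face_elim i1 i2; apply/okP; exists y; split=> //.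
    apply/fintype.subsetP => j jN; rewrite inE.
    have := fintype.subsetP N1 j jN; have := fintype.subsetP N2 j jN.
    by rewrite !inE => /eqP e2 /eqP e1; rewrite yE e1 // e2.
  by move=> j jJ; rewrite yE J1 // J2.
case: (face_sign y0 i) => [[]|] okS; last by rewrite okS in nokN.
  by move: nboth; rewrite okS /= => /negPf->; rewrite addr0.
by move: nboth; rewrite okS andbT => /negPf->; rewrite add0r.
Qed.

Lemma realised_euler J b N :
  \sum_(sigma in realised J b N) (-1) ^+ \dim (sigma_flat J N sigma)
  = (-1) ^+ \dim (flat_of N) :> int.
Proof.
have [n] := ubnP #|J|; elim: n J => // n IHn J.
have [->|[i iJ]] := set_0Vmem J => [_|ltn].
  suff -> : realised finset.set0 b N = [set b]%SET.
    rewrite big_set1; congr (_ ^+ \dim (flat_of _)).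
    by apply/setP => j; rewrite !inE orbF.
  apply/setP => sigma; rewrite inE; apply/imsetP/eqP => [[y _ ->]|->].
    by apply/ffunP => j; rewrite ffunE inE.
  exists (face_one alpha); last by apply/ffunP => j; rewrite ffunE inE.
  by rewrite inE; apply/fintype.subsetP => j _; rewrite inE face_oneE.
rewrite -(finset.setD1K iJ) -(IHn (J :\ i)); last first.
  by move: ltn; rewrite (cardsD1 i) iJ.
have iJ' : i \notin J :\ i by rewrite setD11.
rewrite (partition_big (fun sigma => set_sign sigma i (b i))
  (mem (realised (J :\ i) b N))) /=.
  by apply: eq_bigr => tau tauR; rewrite fiber_euler.
move=> _ /imsetP[y yN ->]; apply/imsetP; exists y => //; apply/ffunP => j.
by rewrite !ffunE !inE; case: eqP => //= ->.
Qed.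

(** The faces [y] with [z y = y] are the products [z y], whose sign vectors are
    those realised for the hyperplanes containing [z] with the signs of [z]
    elsewhere. *)
Lemma face_above_euler z w : zeros w \subset zeros z ->
  \sum_(y | (face_mul z y == y) && (zeros w \subset zeros y))
     (-1) ^+ \dim (supp y)
  = (-1) ^+ \dim (supp w) :> int.
Proof.
move=> wz; rewrite suppE -(realised_euler (zeros z) (face_sign z)).
have -> : realised (zeros z) (face_sign z) (zeros w) =
    [set face_sign y | y in
       [set y | (face_mul z y == y) && (zeros w \subset zeros y)]].
  have mixE y : mix (zeros z) (face_sign z) y = face_sign (face_mul z y).
    by apply/ffunP => j; rewrite face_mulE ffunE inE; case: (face_sign z j).
  apply/setP => sigma; apply/imsetP/imsetP => -[y].
    rewrite inE => yw ->; exists (face_mul z y); last exact: mixE.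
    rewrite inE face_mulA; apply/andP; split.
      apply/eqP/val_inj/ffunP => j; rewrite [LHS]face_mulE [RHS]face_mulE face_mulE.
      by case: (face_sign z j).
    apply/fintype.subsetP => j jw; rewrite inE face_mulE.
    have := fintype.subsetP yw j jw; have := fintype.subsetP wz j jw.
    by rewrite !inE => /eqP-> /eqP->.
  rewrite inE => /andP[/eqP zy yw] ->; exists y; first by rewrite inE.
  by rewrite mixE zy.
rewrite big_imset => [|y1 y2 _ _ /val_inj//] /=.
apply: eq_big => [y|y /andP[/eqP zy yw]]; first by rewrite inE.
rewrite suppE; congr (_ ^+ \dim (flat_of _)); apply/setP => j; rewrite !inE.
apply/idP/orP => [yj|[jw|/andP[]//]].
  right; rewrite yj andbT; move: yj; rewrite -zy face_mulE.
  by case: (face_sign z j).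
by have := fintype.subsetP yw j; rewrite !inE; apply.
Qed.

End EulerRelation.

(** * The support map of the face semigroup *)

Section FaceSupport.
Context {R : realType} {d : nat} {I : finType}.
Variable alpha : I -> 'Hom('rV[R]_d, R^o).
Local Notation face := (face alpha).
Local Notation flat := (flat alpha).
Implicit Types (y z : face) (X Y : flat).

Definition face_flat y : flat := SeqSub (codom_f (@supp R d I alpha) y).

(** A point of [y] lies on exactly the hyperplanes of [zeros y]. *)
Lemma supp_le y z : (supp y <= supp z)%VS = (zeros z \subset zeros y).
Proof.
rewrite !suppE; apply/idP/idP => [yz|zy].
  have [v vy] := face_witness y; rewrite -(witness_flat_of _ vy).
  by apply: (subvP yz); rewrite (witness_flat_of _ vy).
apply/subvP => v /flat_ofP v0; apply/flat_ofP => i iz.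
by rewrite v0 // (fintype.subsetP zy).
Qed.

Lemma face_flat_le y z : (face_flat y <= face_flat z)%O = (face_mul z y == z).
Proof.
rewrite [LHS](supp_le y z); apply/fintype.subsetP/eqP => [zy|<- i].
  apply/val_inj/ffunP => i; rewrite [LHS]face_mulE.
  case zi: (face_sign z i) => [//|].
  by have := zy i; rewrite !inE zi => /(_ isT)/eqP->.
by rewrite !inE face_mulE; case: (face_sign z i).
Qed.

Lemma face_flat_join y z X :
  (face_flat (face_mul y z) <= X)%O =
    (face_flat y <= X)%O && (face_flat z <= X)%O.
Proof.
have /codomP[w Xw] := ssvalP X.
have leE u : (face_flat u <= X)%O = (zeros w \subset zeros u).
  by rewrite -supp_le -Xw.
rewrite !leE -finset.subsetI.
suff -> : zeros (face_mul y z) = zeros y :&: zeros z by [].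
by apply/setP => i; rewrite !inE face_mulE; case: (face_sign y i).
Qed.

Lemma flat_dim_lt X Y : (X < Y)%O -> (\dim (ssval X) < \dim (ssval Y))%N.
Proof.
rewrite lt_neqAle => /andP[nXY leXY].
by rewrite (ltn_leqif (dimv_leqif_sup leXY)); apply: contra nXY => leYX;
  rewrite eq_le leXY.
Qed.

Definition flat_sign X : int := (-1) ^+ \dim (ssval X).

Lemma flat_sign_sq X : flat_sign X * flat_sign X = 1.
Proof. by rewrite -expr2 sqrr_sign. Qed.

Lemma flat_euler z Y : (face_flat z <= Y)%O ->
  \sum_(X | (X <= Y)%O)
     flat_sign X * #|[set y | (face_mul z y == y) && (face_flat y == X)]|%:Z
  = flat_sign Y.
Proof.
move=> zY; have /codomP[w Yw] := ssvalP Y.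
have leE u : (face_flat u <= Y)%O = (zeros w \subset zeros u).
  by rewrite -supp_le -Yw.
have := zY; rewrite leE => /face_above_euler wz.
rewrite {2}/flat_sign Yw -wz.
rewrite (partition_big face_flat (fun X => (X <= Y)%O)) /=; last first.
  by move=> y /andP[_]; rewrite leE.
apply: eq_bigr => X XY; rewrite (eq_bigr (fun=> flat_sign X)); last first.
  by move=> y /andP[_ /eqP <-].
rewrite sumr_const -mulr_natr natz; congr (_ * Posz _); apply: eq_card => y.
rewrite inE unfold_in -leE.
by case: (_ =P X) => [->|]; rewrite ?andbF // XY !andbT.
Qed.

End FaceSupport.

(** * Triangularity and determinant of the Cartan matrix *)

Section CartanMatrix.
Context {k : fieldType} {A : falgType k} {disp : Order.disp_t}.
Context {L : finPOrderType disp}.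
Variables (e : L -> A) (rk : L -> nat).
Hypothesis rk_lt : forall X Y, (X < Y)%O -> (rk X < rk Y)%N.
Hypothesis cartan_le : forall X Y, ~~ (X <= Y)%O -> cartan_inv e X Y = 0%N.
Hypothesis cartan_xx : forall X, cartan_inv e X X = 1%N.

(** Listed by decreasing rank, no element lies below a later one. *)
Lemma exists_trig_order :
  exists2 s : 'I_#|L| -> L, bijective s & is_trig_mx (cartan_mx e s).
Proof.
pose r X Y := (rk Y <= rk X)%N.
pose l := sort r (enum L).
have szl : size l = #|L| by rewrite size_sort -cardE.
have r_tot : total r by move=> X Y; exact: leq_total.
have r_tr : transitive r by move=> Y X Z XY YZ; exact: leq_trans YZ XY.
have l_sorted : sorted r l by exact: sort_sorted.
have uniql : uniq l by rewrite sort_uniq enum_uniq.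
have mem_l X : X \in l by rewrite mem_sort mem_enum.
pose t := Tuple (introT eqP szl).
exists (tnth t).
  apply: inj_card_bij; last by rewrite card_ord.
  exact/tuple_uniqP.
apply/is_trig_mxP => i j ij; rewrite mxE cartan_le //; apply/negP => le_ij.
have X0 : L := tnth t i.
have ne_ij : tnth t i != tnth t j.
  by rewrite (inj_eq (elimT (tuple_uniqP t) uniql)) -val_eqE ltn_eqF.
have : (rk (tnth t i) < rk (tnth t j))%N by apply: rk_lt; rewrite lt_neqAle ne_ij.
apply/negP; rewrite -leqNgt !(tnth_nth X0).
by apply: (sorted_ltn_nth r_tr X0 l_sorted) ij; rewrite inE szl.
Qed.

(** Another listing permutes rows and columns by the same permutation, which
    does not change the determinant. *)
Lemma det_cartan_mx (s : 'I_#|L| -> L) : bijective s -> \det (cartan_mx e s) = 1.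
Proof.
have [s0 bij0 trig0] := exists_trig_order => bij_s.
have [s1 s0K s1K] := bij0.
have inj_p : injective (s1 \o s).
  by apply: inj_comp; [exact: can_inj s1K|exact: bij_inj].
pose p := perm inj_p.
have -> : cartan_mx e s = row_perm p (col_perm p (cartan_mx e s0)).
  by apply/matrixP => i j; rewrite !mxE !permE /= !s1K.
rewrite row_permE col_permE !det_mulmx !det_perm (det_trig trig0).
rewrite big1 => [|i _]; last by rewrite mxE cartan_xx.
by rewrite mul1r odd_permV -signr_addb addbb.
Qed.

End CartanMatrix.

(** * Cartan invariants of the face semigroup algebra *)

Theorem proposition6p4 (k : fieldType) (R : realType) (d : nat) (I : finType)
    (alpha : I -> 'Hom('rV[R]_d, R^o))
    (alpha_neq0 : forall i, alpha i != 0)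
    (hyperplane_inj : injective (hyperplane alpha))
    (x : flat alpha -> face alpha)
    (supp_x : forall X, supp (x X) = ssval X)
    (e : flat alpha -> face_alg k alpha)
    (e_rec : forall X, e X =
       face_elt k (x X) - \sum_(Y : flat alpha | (X < Y)%O) face_elt k (x X) * e Y) :
  [/\ complete_system e,
      forall X Y : flat alpha,
        \dim (homA (left_ideal (e X)) (left_ideal (e Y))) = `|mobius X Y|%N,
      forall X Y : flat alpha, cartan_inv e X Y = `|mobius X Y|%N,
      exists2 s : 'I_#|{: flat alpha}| -> flat alpha,
        bijective s & is_trig_mx (cartan_mx e s) &
      forall s : 'I_#|{: flat alpha}| -> flat alpha,
        bijective s -> \det (cartan_mx e s) = 1].
Proof.
have x_flat X : face_flat (x X) = X by apply: val_inj; rewrite /= supp_x.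
have sup_le := @face_flat_le R d I alpha.
have sup_join := @face_flat_join R d I alpha.
have cE X Y : \dim (homA (left_ideal (e X)) (left_ideal (e Y))) = `|mobius X Y|%N.
  rewrite (dim_homA _ (e_idem sup_le sup_join x_flat e_rec X)).
  apply: (card_mobius (c := cdim e) (@flat_sign_sq _ _ _ alpha)) => [{}X {}Y|Z {}Y ZY].
    exact: (cdim_eq0 sup_le sup_join x_flat e_rec).
  rewrite -[RHS](flat_euler (z := x Z)) ?x_flat //; apply: eq_bigr => X' _.
  by rewrite (card_faces_above sup_le sup_join x_flat e_rec) x_flat.
have cartanE X Y : cartan_inv e X Y = `|mobius X Y|%N by exact: cE.
have cartan_le X Y : ~~ (X <= Y)%O -> cartan_inv e X Y = 0%N.
  by move=> nXY; rewrite cartanE mobius_nle.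
have cartan_xx X : cartan_inv e X X = 1%N by rewrite cartanE mobius_xx.
split=> //.
- exact: (e_complete sup_le sup_join x_flat e_rec).
- exact: (exists_trig_order (@flat_dim_lt _ _ _ alpha) cartan_le).
- exact: (det_cartan_mx (@flat_dim_lt _ _ _ alpha) cartan_le cartan_xx).
Qed.
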